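(* For every finite simple graph $G$ with minimum degree $\delta(G)$ and every positive integer $k$, $$d_R^k(G)\le \delta(G)+2k.$$ Moreover, the upper bound is sharp: for every positive integer $k$ there exists a graph $G$ with $d_R^k(G)=\delta(G)+2k$.
   Context: Let $k\ge1$ be an integer. A Roman $k$-dominating function (RkDF) on a graph $G$ is a map $f:V(G)\to\{0,1,2\}$ such that every vertex $v$ with $f(v)=0$ has at least $k$ neighbors $u$ with $f(u)=2$. A set $\{f_1,\ldots,f_d\}$ of pairwise distinct RkDFs on $G$ with $\sum_{i=1}^d f_i(v)\le 2k$ for every $v\in V(G)$ is a Roman $(k,k)$-dominating family on $G$; the maximum number of functions in such a family is the Roman $(k,k)$-domatic number $d_R^k(G)$. *)

(* Defs.v *)
From mathcomp Require Import all_boot.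

Set Implicit Arguments.
Unset Strict Implicit.
Unset Printing Implicit Defensive.

Record sgraph := SGraph {
  vertex :> finType;
  adj : rel vertex;
  adj_sym : symmetric adj;
  adj_irr : irreflexive adj }.

Definition degree (G : sgraph) (v : G) : nat := #|[set u | adj v u]|.

(* Every degree is smaller than #|G|, so the default value #|G| does not affect
   the minimum as soon as G has a vertex. *)
Definition min_degree (G : sgraph) : nat :=
  \big[minn/#|G|]_(v : G) degree v.

Definition RkDF (k : nat) (G : sgraph) (f : {ffun G -> 'I_3}) : bool :=
  [forall v : G, (f v == 0 :> nat) ==>
     (k <= #|[set u | adj v u & f u == 2 :> nat]|)].

(* The functions of a family are pairwise distinct because F is a set. *)
Definition roman_dominating_family (k : nat) (G : sgraph)
    (F : {set {ffun G -> 'I_3}}) : bool :=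
  [forall f in F, RkDF k f] &&
  [forall v : G, \sum_(f in F) (f v : nat) <= 2 * k].

Definition roman_domatic_number (k : nat) (G : sgraph) : nat :=
  \max_(F : {set {ffun G -> 'I_3}} | roman_dominating_family k F) #|F|.

(* Main.v *)
Require Import Defs.
From mathcomp Require Import all_boot.

Set Implicit Arguments.
Unset Strict Implicit.
Unset Printing Implicit Defensive.

(** Fix a vertex [v].  At most [2k] functions of a family are nonzero at [v],
    since their values at [v] sum to at most [2k].  Every other function of the
    family has weight at least [2k] on the neighbourhood of [v], where the whole
    family has weight at most [2k deg(v)]; so there are at most [deg(v)] of
    them.

    The bound is attained by the disjoint union of an isolated vertex and the
    complete graph on [2k] disjoint blocks of size [k]: the [i]-th function is
    [1] at the isolated vertex, [2] on the [i]-th block and [0] elsewhere. *)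

Lemma card_roman_dominating_family (k : nat) (G : sgraph)
    (F : {set {ffun G -> 'I_3}}) (v : G) :
  0 < k -> roman_dominating_family k F -> #|F| <= degree v + 2 * k.
Proof.
move=> k_gt0 /andP[/forall_inP domF /forallP sumF].
rewrite -(cardsID [set f : {ffun G -> 'I_3} | f v == 0 :> nat] F) leq_add //.
(* After multiplication by [2 * k], both sides compare with the total weight of [F] on the
   neighbourhood of [v]. *)
- rewrite -(leq_pmul2l (_ : 0 < 2 * k)) ?muln_gt0 //.
  apply: (@leq_trans (\sum_(f in F) \sum_(u | adj v u) (f u : nat))); last first.
    rewrite exchange_big /= mulnC /degree cardsE -sum_nat_const.
    by apply: leq_sum => u _.
  rewrite mulnC -sum_nat_const [leqRHS](big_setID
    [set f : {ffun G -> 'I_3} | f v == 0 :> nat]) /=.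
  apply: leq_trans (leq_addr _ _); apply: leq_sum => f.
  rewrite !inE => /andP[/domF/forallP/(_ v)/implyP kdom /kdom].
  (* The weight [2 * k] comes from [k] neighbours of [v] with value 2. *)
  move=> le_k; apply: (@leq_trans (\sum_(u | adj v u && (f u == 2 :> nat)) 2)).
    by rewrite sum_nat_cond_const [leqRHS]mulnC leq_mul2l.
  rewrite [leqRHS](bigID (fun u => f u == 2 :> nat)) /=.
  by apply: leq_trans (leq_addr _ _); apply: leq_sum => u /andP[_ /eqP->].
- apply: leq_trans (sumF v); rewrite [leqRHS](big_setID
    [set f : {ffun G -> 'I_3} | f v == 0 :> nat]) /=.
  apply: leq_trans (leq_addl _ _); rewrite -sum1_card; apply: leq_sum => f.
  by rewrite !inE lt0n => /andP[].
Qed.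

Lemma min_degree_le (G : sgraph) (v : G) : min_degree G <= degree v.
Proof.
rewrite /min_degree; have := mem_index_enum v.
elim: (index_enum _) => // u s IHs; rewrite inE big_cons geq_min.
by case/predU1P => [<-|/IHs->]; rewrite ?leqnn ?orbT.
Qed.

Lemma roman_domatic_number_le (k : nat) (G : sgraph) :
  0 < k -> 0 < #|G| -> roman_domatic_number k G <= min_degree G + 2 * k.
Proof.
move=> k_gt0 /card_gt0P[v0 _]; apply/bigmax_leqP => F famF.
rewrite /min_degree; apply: (big_ind (fun d => #|F| <= d + 2 * k)).
(* The default value [#|G|] of the minimum also satisfies the bound, because it is at least the
   degree of [v0]. *)
- apply: leq_trans (card_roman_dominating_family v0 k_gt0 famF) _.
  by rewrite leq_add2r max_card.
- by move=> m n le_m le_n; rewrite addn_minl leq_min le_m.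
- by move=> v _; exact: card_roman_dominating_family.
Qed.

Section IsolatedPlusComplete.

Variable T : finType.

(** [None] is the isolated vertex; the vertices [Some t] form the complete graph. *)
Definition isolated_complete_rel (x y : option T) :=
  [&& x != None, y != None & x != y].

Lemma isolated_complete_sym : symmetric isolated_complete_rel.
Proof. by move=> x y; rewrite /isolated_complete_rel andbCA [x == y]eq_sym. Qed.

Lemma isolated_complete_irr : irreflexive isolated_complete_rel.
Proof. by move=> x; rewrite /isolated_complete_rel eqxx !andbF. Qed.

Definition isolated_complete : sgraph :=
  SGraph isolated_complete_sym isolated_complete_irr.

Lemma min_degree_isolated_complete : min_degree isolated_complete = 0.
Proof.
apply/eqP; rewrite -leqn0.
apply: leq_trans (min_degree_le (None : isolated_complete)) _.
by rewrite leqn0 cards_eq0; apply/eqP/setP => x; rewrite !inE.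
Qed.

End IsolatedPlusComplete.

Section BlockFamily.

Variables (n k : nat).

Local Notation G := (isolated_complete ('I_n * 'I_k)%type).

(** [Some (j, a)] stands for the vertex at position [a] of block [j]. *)
Definition block_function (i : 'I_n) : {ffun G -> 'I_3} :=
  [ffun x : G => if x is Some p then (if p.1 == i then inord 2 else inord 0)
                 else inord 1].

Lemma block_function_val (i : 'I_n) (x : G) :
  block_function i x = (if x is Some p then 2 * (p.1 == i) else 1) :> nat.
Proof. by rewrite ffunE; case: x => [p|]; [case: eqP|]; rewrite inordK. Qed.

(** Block [i] is nonempty as [0 < k], and its first vertex tells [i] from any other index. *)
Lemma block_function_inj : 0 < k -> injective block_function.
Proof.
move=> k_gt0 i j /ffunP/(_ (Some (i, Ordinal k_gt0)))/(congr1 val) /=.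
by rewrite !block_function_val /= eqxx; case: eqP.
Qed.

Lemma block_function_RkDF (i : 'I_n) : RkDF k (block_function i).
Proof.
apply/forallP => x; apply/implyP; rewrite block_function_val.
case: x => [[j a]|] //=; rewrite muln_eq0 /= eqb0 => neq_ji.
have inj_block : injective (fun b : 'I_k => Some (i, b) : G).
  by move=> b c [].
(* All [k] vertices of block [i] have value 2 and are adjacent to a vertex of another block. *)
rewrite -[leqLHS]card_ord -(card_imset _ inj_block); apply: subset_leq_card.
apply/subsetP => _ /imsetP[b _ ->]; rewrite !inE block_function_val /= eqxx.
rewrite andbT /isolated_complete_rel /=.
by apply: contra neq_ji => /eqP[->].
Qed.

Lemma block_family_dominating : 0 < k -> n <= 2 * k ->
  roman_dominating_family k [set block_function i | i : 'I_n].
Proof.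
move=> k_gt0 le_n; apply/andP; split.
  by apply/forall_inP => _ /imsetP[i _ ->]; exact: block_function_RkDF.
apply/forallP => x; rewrite big_imset /=; last first.
  by move=> i j _ _; exact: block_function_inj.
under eq_bigr do rewrite block_function_val.
(* At the isolated vertex the sum is [n], whence the condition [n <= 2 * k]; at [p] only the
   function of the block of [p] contributes, with value 2. *)
case: x => [p|]; last by rewrite sum_nat_const card_ord muln1.
rewrite -big_distrr leq_mul2l /= (bigD1 p.1) //= eqxx big1 ?addn0 //.
by move=> i neq_i; rewrite eq_sym (negPf neq_i).
Qed.

End BlockFamily.

Theorem theorem5 (k : nat) (k_gt0 : 0 < k) :
  (forall G : sgraph, 0 < #|G| ->
     roman_domatic_number k G <= min_degree G + 2 * k) /\
  (exists G : sgraph, 0 < #|G| /\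
     roman_domatic_number k G = min_degree G + 2 * k).
Proof.
split=> [G|]; first exact: roman_domatic_number_le.
exists (isolated_complete ('I_(2 * k) * 'I_k)%type).
have G_gt0 : 0 < #|isolated_complete ('I_(2 * k) * 'I_k)%type|.
  by apply/card_gt0P; exists None.
split=> //; apply/eqP; rewrite eqn_leq roman_domatic_number_le //=.
(* The minimum degree is 0, so a family of [2 * k] distinct functions suffices. *)
rewrite min_degree_isolated_complete add0n -[leqLHS]card_ord.
rewrite -(card_imset _ (block_function_inj (n := 2 * k) k_gt0)).
exact: leq_bigmax_cond (block_family_dominating k_gt0 (leqnn _)).
Qed.
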